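(* Let $(x^k,y^k,s^k)_{k\ge 0}$ be the iterates of the short-step inexact feasible interior point method (IF-IPM) described in the context, started from $(x^0,y^0,s^0)\in\mathcal N(\theta)$, and let $\mu^k=(x^k)^Ts^k/n$. Then the sequence $\mu^k$ converges to zero linearly, and $\mu^k\le \zeta$ holds after $$O\!\left(\sqrt n\,\log\frac{\mu^0}{\zeta}\right)$$ iterations.
   Context: Let $A\in\mathbb R^{m\times n}$ have rank $m$, $b\in\mathbb R^m$, $c\in\mathbb R^n$. The linear optimization (LO) pair is: $\min c^Tx$ s.t. $Ax=b$, $x\ge0$; and $\max b^Ty$ s.t. $A^Ty+s=c$, $s\ge0$. Let $\mathcal{PD}^0=\{(x,y,s): Ax=b,\ A^Ty+s=c,\ x>0,\ s>0\}$, assumed nonempty. For $(x,y,s)$ write $X=\mathrm{diag}(x)$, $S=\mathrm{diag}(s)$, $e$ the all-one vector, $\mu=x^Ts/n$, and $\mathcal N(\theta)=\{(x,y,s)\in\mathcal{PD}^0:\ \|XSe-\mu e\|_2\le\theta\mu\}$. A feasible point is $\zeta$-optimal if $x^Ts/n\le\zeta$. $\|\cdot\|$ is the 2-norm. Assume the first $m$ columns of $A=[A_B\ A_N]$ are linearly independent and put $V=\begin{bmatrix}A_B^{-1}A_N\\-I\end{bmatrix}\in\mathbb R^{n\times(n-m)}$, so $AV=0$. Orthogonal Subspaces System (OSS) at $(x,y,s)$: $Mz=\sigma$ with $M=[-XA^T\ \ SV]$, $z=(\Delta y,\lambda)$, $\sigma=\beta\mu e-Xs$ (here $Xs$ is the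 vector with entries $x_is_i$). IF-IPM: fix $\zeta>0$, $\eta=0.1$, $\theta=0.2$, $\beta=1-\frac{0.11}{\sqrt n}$ and $(x^0,y^0,s^0)\in\mathcal N(\theta)$. At iteration $k$, compute any approximate solution $\tilde z^k=(\Delta y^k,\lambda^k)$ of the OSS at $(x^k,y^k,s^k)$ whose distance in 2-norm to the exact solution is at most $\eta\mu^k/\|M^k\|$ (so that the residual $r^k=M^k\tilde z^k-\sigma^k$ satisfies $\|r^k\|\le\eta\mu^k$); set $\Delta x^k=V\lambda^k$, $\Delta s^k=-A^T\Delta y^k$, and $(x^{k+1},y^{k+1},s^{k+1})=(x^k,y^k,s^k)+(\Delta x^k,\Delta y^k,\Delta s^k)$. The method stops at the first $k$ at which the iterate is $\zeta$-optimal; for the statement that $\mu^k\to0$ the iteration is regarded as continued indefinitely. *)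

(* Defs.v *)
From mathcomp Require Import all_boot all_order all_algebra.
From mathcomp Require Import all_classical all_reals all_analysis.
Set Implicit Arguments.
Unset Strict Implicit.
Unset Printing Implicit Defensive.
Import Order.TTheory GRing.Theory Num.Theory.
Import numFieldNormedType.Exports.
Local Open Scope classical_set_scope.
Local Open Scope ring_scope.

(* The library norm on matrices is the max norm, hence the definitions of the
   2-norm of a vector and of the operator norm it induces. *)
Definition norm2 (R : realType) (n : nat) (v : 'cV[R]_n) : R :=
  Num.sqrt (\sum_(i < n) v i 0 ^+ 2).

Definition opnorm2 (R : realType) (m n : nat) (M : 'M[R]_(m, n)) : R :=
  sup [set norm2 (M *m z) | z in [set z : 'cV[R]_n | norm2 z <= 1]].

Definition converges_linearly (R : realType) (u : nat -> R) (l : R) : Prop :=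
  u @ \oo --> l /\
  exists rho : R, [/\ 0 <= rho, rho < 1 &
    forall k : nat, `|u k.+1 - l| <= rho * `|u k - l|].

Record pd_point (R : realType) (m n : nat) := PDPoint {
  pdx : 'cV[R]_n;
  pdy : 'cV[R]_m;
  pds : 'cV[R]_n
}.

(* diag v is the diagonal matrix of a column vector (diag_mx takes a row). *)
Definition diag (R : realType) (n : nat) (v : 'cV[R]_n) : 'M[R]_n :=
  diag_mx v^T.

Definition ones (R : realType) (n : nat) : 'cV[R]_n := const_mx 1.
Arguments ones {R n}.

Definition mu (R : realType) (m n : nat) (w : pd_point R m n) : R :=
  ((pdx w)^T *m pds w) 0 0 / n%:R.

Definition PD0 (R : realType) (m n : nat)
    (A : 'M[R]_(m, n)) (b : 'cV[R]_m) (c : 'cV[R]_n) : set (pd_point R m n) :=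
  [set w | [/\ A *m pdx w = b,
               A^T *m pdy w + pds w = c,
               forall i, 0 < pdx w i 0 &
               forall i, 0 < pds w i 0]].

Definition nbhd2 (R : realType) (m n : nat)
    (A : 'M[R]_(m, n)) (b : 'cV[R]_m) (c : 'cV[R]_n) (theta : R) :
    set (pd_point R m n) :=
  [set w | PD0 A b c w /\
     norm2 (diag (pdx w) *m diag (pds w) *m ones - mu w *: ones)
       <= theta * mu w].

(* The number of columns of A is written m + p, so that A = [A_B A_N] with
   A_B = lsubmx A and A_N = rsubmx A, and n - m = p. *)
Definition nullV (R : realType) (m p : nat) (A : 'M[R]_(m, m + p)) :
    'M[R]_(m + p, p) :=
  col_mx (invmx (lsubmx A) *m rsubmx A) (- 1%:M).

Definition oss_mx (R : realType) (m p : nat) (A : 'M[R]_(m, m + p))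
    (w : pd_point R m (m + p)) : 'M[R]_(m + p) :=
  row_mx (- (diag (pdx w) *m A^T)) (diag (pds w) *m nullV A).

Definition oss_rhs (R : realType) (m p : nat) (beta : R)
    (w : pd_point R m (m + p)) : 'cV[R]_(m + p) :=
  (beta * mu w) *: ones - diag (pdx w) *m pds w.

(* Quantifying over every exact solution z, rather than asserting that one
   exists, keeps the solvability of the system out of the assumptions. *)
Definition oss_approx (R : realType) (m p : nat) (A : 'M[R]_(m, m + p))
    (eta beta : R) (w : pd_point R m (m + p))
    (dy : 'cV[R]_m) (lam : 'cV[R]_p) : Prop :=
  forall z : 'cV[R]_(m + p),
    oss_mx A w *m z = oss_rhs beta w ->
    norm2 (col_mx dy lam - z) <= eta * mu w / opnorm2 (oss_mx A w).

Definition ifipm_step (R : realType) (m p : nat) (A : 'M[R]_(m, m + p))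
    (eta beta : R) (w w' : pd_point R m (m + p)) : Prop :=
  exists dy : 'cV[R]_m, exists lam : 'cV[R]_p,
    oss_approx A eta beta w dy lam /\
    w' = PDPoint (pdx w + nullV A *m lam) (pdy w + dy)
                 (pds w + - (A^T *m dy)).

Definition ifipm_eta (R : realType) : R := 1 / 10.
Definition ifipm_theta (R : realType) : R := 2 / 10.
Definition ifipm_beta (R : realType) (n : nat) : R :=
  1 - (11 / 100) / Num.sqrt n%:R.

(* w 0, ..., w K are produced by K iterations; a run halted by the stopping
   test is covered, since w is unconstrained beyond K. *)
Definition ifipm_run (R : realType) (m p : nat) (A : 'M[R]_(m, m + p))
    (b : 'cV[R]_m) (c : 'cV[R]_(m + p))
    (w : nat -> pd_point R m (m + p)) (K : nat) : Prop :=
  nbhd2 A b c (ifipm_theta R) (w 0%N) /\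
  forall k : nat, (k < K)%N ->
    ifipm_step A (ifipm_eta R) (ifipm_beta R (m + p)) (w k) (w k.+1).

(* Main.v *)
Require Import Defs.
From mathcomp Require Import all_boot all_order all_algebra.
From mathcomp Require Import all_classical all_reals all_analysis.
From mathcomp Require Import ring lra.
Import Order.TTheory GRing.Theory Num.Theory.
Import numFieldNormedType.Exports.
Local Open Scope classical_set_scope.
Local Open Scope ring_scope.

(** Write [n = m + p], [g = sqrt n], and let [dx = V lam], [ds = - A^T dy] be
    the displacements of one step from a point [(x, y, s)] of the neighbourhood.
    Since [A V = 0], the step stays feasible however inexact it is, and [dx] is
    orthogonal to [ds]. The same orthogonality makes the system matrix
    invertible ([oss_mx_unit]), so an exact solution exists, and the accuracy
    [eta mu / |M|] asked of the approximate one becomes a residual [r] with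
    [|r| <= eta mu] ([oss_residual]). Thus, componentwise,
    [s dx + x ds = beta mu - x s + r], which is an inexact Newton equation.

    Adding [x s] and [dx ds] gives
    [(x + dx) (s + ds) = beta mu + r + dx ds]. Summing over components, the last
    term vanishes and the new duality measure is [beta mu + a], with [a] the mean
    of [r] ([mu_newton]). As [|a| <= |r| / g <= mu / (10 g)], this is at most
    [(1 - 0.11 / g + 0.1 / g) mu = (1 - 0.01 / g) mu] and at least
    [(1 - 0.21) mu].

    The new deviation from the central path is [r - a e + dx ds]. Centring does
    not increase the norm, so the first part costs [0.1 mu]; the second order
    term costs [0.048 mu] ([norm2_second_order]), because
    [4 dx ds <= (s dx + x ds)^2 / (x s)] and the entries of [dx ds] sum to zero.
    The total [0.148 mu] is below [0.2 * 0.79 mu], so the neighbourhood is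
    preserved ([ifipm_step_nbhd]) and [mu] contracts by [rho = 1 - 1 / (100 g)]
    at each step. Hence linear convergence; and
    [rho ^ K <= exp (- K / (100 g))] gives the iteration bound with the
    constant 100. *)

Set Implicit Arguments.
Unset Strict Implicit.

(** * Finite sums *)

Lemma cauchy_schwarz_sum (R : realFieldType) (I : finType) (a b : I -> R) :
  (\sum_i a i * b i) ^+ 2 <= (\sum_i a i ^+ 2) * (\sum_i b i ^+ 2).
Proof.
set P := \sum_i a i * b i; set S := \sum_i a i ^+ 2; set T := \sum_i b i ^+ 2.
have T_ge0 : 0 <= T by apply: sumr_ge0 => i _; exact: sqr_ge0.
have quad_ge0 : 0 <= T * (S * T - P ^+ 2).
  suff -> : T * (S * T - P ^+ 2) = \sum_i (T * a i - P * b i) ^+ 2.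
    by apply: sumr_ge0 => i _; exact: sqr_ge0.
  have sumE (t p : R) : \sum_i (t * a i - p * b i) ^+ 2 =
      t ^+ 2 * S - 2 * t * p * P + p ^+ 2 * T.
    rewrite /S /P /T !mulr_sumr -sumrB -big_split /=.
    by apply: eq_bigr => i _; ring.
  by rewrite sumE; ring.
case: (ltgtP T 0) T_ge0 => // [T_gt0 _|T0 _].
  by move: quad_ge0; rewrite pmulr_rge0// subr_ge0.
have b0 i : b i = 0.
  apply/eqP; rewrite -sqrf_eq0; apply/eqP.
  exact: (psumr_eq0P (fun j _ => sqr_ge0 (b j)) T0).
by rewrite T0 mulr0 /P big1 ?expr0n// => i _; rewrite b0 mulr0.
Qed.

Lemma sum_sqr_le_sqr_sum (R : realFieldType) (I : finType) (f : I -> R) :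
  (forall i, 0 <= f i) -> \sum_i f i ^+ 2 <= (\sum_i f i) ^+ 2.
Proof.
move=> f_ge0; rewrite (expr2 (\sum_i f i)) mulr_suml; apply: ler_sum => i _.
rewrite expr2 ler_wpM2l// (bigD1 i)//= lerDl.
by apply: sumr_ge0 => j _.
Qed.

(** The positive and the negative part of [w] have the same sum, since [w] sums
    to zero, and that sum is at most the sum of [q]; each part contributes at
    most the square of it. *)
Lemma sum_sqr_zero_sum (R : realFieldType) (I : finType) (w q : I -> R) :
  \sum_i w i = 0 -> (forall i, w i <= q i) -> (forall i, 0 <= q i) ->
  \sum_i w i ^+ 2 <= 2 * (\sum_i q i) ^+ 2.
Proof.
move=> sum_w0 w_le q_ge0.
pose wp i := Num.max (w i) 0; pose wn i := Num.max (- w i) 0.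
have wp_ge0 i : 0 <= wp i by rewrite /wp le_max lexx orbT.
have wn_ge0 i : 0 <= wn i by rewrite /wn le_max lexx orbT.
have wE i : w i = wp i - wn i.
  by rewrite /wp /wn; case: (leP (w i) 0); case: (leP (- w i) 0) => *; lra.
have sqE i : w i ^+ 2 = wp i ^+ 2 + wn i ^+ 2.
  by rewrite /wp /wn; case: (leP (w i) 0); case: (leP (- w i) 0) => *; nra.
have wpn : \sum_i wn i = \sum_i wp i.
  apply/esym/eqP; rewrite -subr_eq0 -sumrB -(eq_bigr _ (fun i _ => wE i)).
  by rewrite sum_w0.
have wp_le : \sum_i wp i <= \sum_i q i.
  by apply: ler_sum => i _; rewrite /wp ge_max w_le q_ge0.
have wp_sum_ge0 : 0 <= \sum_i wp i by apply: sumr_ge0.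
rewrite (eq_bigr _ (fun i _ => sqE i)) big_split /=.
have := sum_sqr_le_sqr_sum wp_ge0.
have := sum_sqr_le_sqr_sum wn_ge0.
have : (\sum_i wp i) ^+ 2 <= (\sum_i q i) ^+ 2.
  by rewrite ler_sqr ?nnegrE ?(le_trans wp_sum_ge0).
by rewrite wpn; move: (\sum_i wn i ^+ 2) => t; lra.
Qed.

(** * The Euclidean norm and its operator norm *)

Section Norm2.
Variable R : realType.
Implicit Types (m n : nat).

Lemma norm2_ge0 n (v : 'cV[R]_n) : 0 <= norm2 v.
Proof. exact: sqrtr_ge0. Qed.

Lemma sqr_norm2 n (v : 'cV[R]_n) : norm2 v ^+ 2 = \sum_i v i 0 ^+ 2.
Proof. by rewrite sqr_sqrtr// sumr_ge0// => i _; exact: sqr_ge0. Qed.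

Lemma norm2_le_sqr n (v : 'cV[R]_n) (t : R) :
  0 <= t -> (norm2 v <= t) = (\sum_i v i 0 ^+ 2 <= t ^+ 2).
Proof. by move=> t0; rewrite -sqr_norm2 ler_sqr ?nnegrE ?norm2_ge0. Qed.

Lemma norm2_sqr_le n (v : 'cV[R]_n) (t : R) :
  norm2 v <= t -> norm2 v ^+ 2 <= t ^+ 2.
Proof.
move=> v_le; have v_ge0 := norm2_ge0 v.
by rewrite ler_sqr// nnegrE (le_trans v_ge0).
Qed.

Lemma norm2_eq0 n (v : 'cV[R]_n) : norm2 v = 0 -> v = 0.
Proof.
move=> v0; have := sqr_norm2 v; rewrite v0 expr0n /= => /esym s0.
apply/matrixP => i j; rewrite ord1 mxE; apply/eqP; rewrite -sqrf_eq0; apply/eqP.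
exact: (psumr_eq0P (fun j _ => sqr_ge0 (v j 0)) s0).
Qed.

Lemma norm20 n : norm2 (0 : 'cV[R]_n) = 0.
Proof. by rewrite /norm2 big1 ?sqrtr0// => i _; rewrite mxE expr0n. Qed.

Lemma norm2Z n (a : R) (v : 'cV[R]_n) : norm2 (a *: v) = `|a| * norm2 v.
Proof.
rewrite /norm2 -sqrtr_sqr -sqrtrM ?sqr_ge0// mulr_sumr.
by congr Num.sqrt; apply: eq_bigr => i _; rewrite mxE exprMn.
Qed.

Lemma norm2_entry n (v : 'cV[R]_n) i : `|v i 0| <= norm2 v.
Proof.
rewrite -ler_sqr ?nnegrE ?norm2_ge0// real_normK ?num_real// sqr_norm2.
by rewrite (bigD1 i)//= lerDl sumr_ge0// => j _; exact: sqr_ge0.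
Qed.

Lemma norm2_sum_mul n (u v : 'cV[R]_n) :
  `|\sum_i u i 0 * v i 0| <= norm2 u * norm2 v.
Proof.
rewrite -ler_sqr ?nnegrE ?mulr_ge0 ?norm2_ge0// real_normK ?num_real//.
by rewrite exprMn !sqr_norm2 cauchy_schwarz_sum.
Qed.

Lemma norm2D n (u v : 'cV[R]_n) : norm2 (u + v) <= norm2 u + norm2 v.
Proof.
rewrite norm2_le_sqr ?addr_ge0 ?norm2_ge0//.
have -> : \sum_i (u + v) i 0 ^+ 2 =
    norm2 u ^+ 2 + 2 * (\sum_i u i 0 * v i 0) + norm2 v ^+ 2.
  rewrite !sqr_norm2 mulr_sumr -!big_split /=.
  by apply: eq_bigr => i _; rewrite mxE; ring.
have := norm2_sum_mul u v; move/(le_trans (ler_norm _)).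
by nra.
Qed.

Lemma norm2_ones n : norm2 (ones : 'cV[R]_n) = Num.sqrt n%:R.
Proof.
rewrite /norm2 (eq_bigr (fun=> 1)) => [|i _]; last by rewrite mxE expr1n.
by rewrite sumr_const card_ord.
Qed.

(** Any bound of this shape would do: it is what makes the supremum defining
    the operator norm a genuine one. *)
Lemma norm2_mulmx_frobenius m n (M : 'M[R]_(m, n)) (v : 'cV[R]_n) :
  norm2 (M *m v) <= Num.sqrt (\sum_i \sum_j M i j ^+ 2) * norm2 v.
Proof.
have F_ge0 : 0 <= \sum_i \sum_j M i j ^+ 2.
  by do 2![apply: sumr_ge0 => ? _]; exact: sqr_ge0.
rewrite norm2_le_sqr ?mulr_ge0 ?sqrtr_ge0 ?norm2_ge0//.
rewrite exprMn sqr_sqrtr// sqr_norm2 mulr_suml; apply: ler_sum => i _.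
by rewrite mxE; exact: cauchy_schwarz_sum.
Qed.

Lemma norm2_mulmx_unit_ball m n (M : 'M[R]_(m, n)) (z : 'cV[R]_n) :
  norm2 z <= 1 -> norm2 (M *m z) <= opnorm2 M.
Proof.
move=> z_le1; apply: ub_le_sup; last by exists z.
exists (Num.sqrt (\sum_i \sum_j M i j ^+ 2)) => _ [y /= y_le1 <-].
apply: (le_trans (norm2_mulmx_frobenius M y)).
by rewrite ler_piMr// sqrtr_ge0.
Qed.

Lemma opnorm2_ge0 m n (M : 'M[R]_(m, n)) : 0 <= opnorm2 M.
Proof.
apply: (le_trans (norm2_ge0 (M *m 0))).
by apply: norm2_mulmx_unit_ball; rewrite norm20 ler01.
Qed.

Lemma norm2_mulmx_opnorm2 m n (M : 'M[R]_(m, n)) (v : 'cV[R]_n) :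
  norm2 (M *m v) <= opnorm2 M * norm2 v.
Proof.
have [/norm2_eq0 ->|v_neq0] := eqVneq (norm2 v) 0.
  by rewrite mulmx0 !norm20 mulr0.
have v_gt0 : 0 < norm2 v by rewrite lt_def v_neq0 norm2_ge0.
rewrite -ler_pdivrMr// mulrC -[(norm2 v)^-1]ger0_norm ?invr_ge0 ?norm2_ge0//.
rewrite -norm2Z scalemxAr; apply: norm2_mulmx_unit_ball.
by rewrite norm2Z ger0_norm ?invr_ge0 ?norm2_ge0// mulVf.
Qed.

Lemma diagE n (u v : 'cV[R]_n) i : (diag u *m v) i 0 = u i 0 * v i 0.
Proof. by rewrite mul_diag_mx !mxE. Qed.

Lemma dotE n (u v : 'cV[R]_n) : (u^T *m v) 0 0 = \sum_i u i 0 * v i 0.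
Proof. by rewrite mxE; apply: eq_bigr => i _; rewrite mxE. Qed.

(** Subtracting the mean is the orthogonal projection onto the complement of
    the all-one vector. *)
Lemma norm2_center n (u : 'cV[R]_n) :
  norm2 (u - ((\sum_i u i 0) / n%:R) *: ones) <= norm2 u.
Proof.
rewrite norm2_le_sqr ?norm2_ge0// sqr_norm2.
set a := _ / _.
have [n0|n_neq0] := eqVneq (n%:R : R) 0.
  by apply: ler_sum => i _; rewrite /a n0 invr0 mulr0 scale0r subr0.
have sumE : \sum_i u i 0 = n%:R * a by rewrite /a mulrC divfK.
rewrite (eq_bigr (fun i => (u i 0 ^+ 2 - 2 * a * u i 0) + a ^+ 2)); last first.
  by move=> i _; rewrite !mxE; ring.
rewrite big_split sumrB /= -mulr_sumr sumE sumr_const card_ord -mulr_natl.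
have : 0 <= n%:R * a ^+ 2 by rewrite mulr_ge0 ?sqr_ge0.
by move: (\sum_i _) => t; nra.
Qed.

Lemma abs_mean_le n (u : 'cV[R]_n) : (0 < n)%N ->
  `|(\sum_i u i 0) / n%:R| <= norm2 u / Num.sqrt n%:R.
Proof.
move=> n_gt0; set g : R := Num.sqrt n%:R.
have g_gt0 : 0 < g by rewrite sqrtr_gt0 ltr0n.
have gg : g * g = n%:R by rewrite -expr2 sqr_sqrtr.
rewrite normrM normfV normr_nat ler_pdivrMr ?ltr0n// -gg mulrA divfK ?gt_eqF//.
have := norm2_sum_mul u ones; rewrite norm2_ones -/g.
by under eq_bigr do rewrite [ones _ _]mxE mulr1.
Qed.

(** The classical bound on the second order term of a primal-dual Newton step:
    with the scaled vectors [d = dx (s / x)^(1/2)] and [d' = ds (x / s)^(1/2)]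
    it reads [|d d'| <= 2^(-3/2) |d + d'|^2]. Squaring [d + d'] yields
    [4 dx ds <= h^2 / (x s)] entry by entry, where the entries of [dx ds] sum to
    zero. *)
Lemma norm2_hadamard_orthogonal n (x s dx ds h : 'cV[R]_n) (delta : R) :
  0 < delta -> (forall i, delta <= x i 0 * s i 0) ->
  \sum_i dx i 0 * ds i 0 = 0 ->
  (forall i, s i 0 * dx i 0 + x i 0 * ds i 0 = h i 0) ->
  norm2 (diag dx *m ds) ^+ 2 <= 2 * (norm2 h ^+ 2 / (4 * delta)) ^+ 2.
Proof.
move=> delta_gt0 xs_ge orth hE.
rewrite !sqr_norm2 mulr_suml.
rewrite (eq_bigr _ (fun i _ => congr1 (fun t => t ^+ 2) (diagE dx ds i))).
have d4_gt0 : 0 < 4 * delta by lra.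
apply: sum_sqr_zero_sum => // i; last by rewrite divr_ge0 ?sqr_ge0 ?ltW.
rewrite ler_pdivlMr// -hE.
have := xs_ge i; have := sqr_ge0 (s i 0 * dx i 0 - x i 0 * ds i 0).
have := sqr_ge0 (s i 0 * dx i 0 + x i 0 * ds i 0).
have [p_ge0|p_lt0] := leP 0 (dx i 0 * ds i 0); last first.
  by move=> *; apply: (@le_trans _ _ 0) => //; nra.
move=> _ sq_ge0 xs_ge_i.
apply: (@le_trans _ _ (4 * (dx i 0 * ds i 0) * (x i 0 * s i 0))).
  by rewrite mulrCA mulrA ler_wpM2l// mulr_ge0.
by move: sq_ge0; rewrite !expr2; nra.
Qed.
End Norm2.

(** * The orthogonal subspaces system *)

Section OSS.
Variables (R : realType) (m p : nat) (A : 'M[R]_(m, m + p)).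
Hypothesis rankA : \rank A = m.
Hypothesis freeAB : row_free (lsubmx A)^T.

Let A_B_unit : lsubmx A \in unitmx.
Proof. by rewrite -unitmx_tr -row_free_unit. Qed.

Lemma mulmx_nullV : A *m nullV A = 0.
Proof.
rewrite -{1}[A]hsubmxK mul_row_col mulmxA mulmxV// mul1mx.
by rewrite mulmxN mulmx1 subrr.
Qed.

Lemma nullV_inj (lam : 'cV[R]_p) : nullV A *m lam = 0 -> lam = 0.
Proof.
rewrite mul_col_mx mulNmx mul1mx -col_mx0 => /eq_col_mx [_ /eqP].
by rewrite oppr_eq0 => /eqP.
Qed.

Lemma trmx_full_rank_inj (y : 'cV[R]_m) : A^T *m y = 0 -> y = 0.
Proof.
move=> Ay0; have freeA : row_free A by rewrite /row_free rankA.
apply/eqP; rewrite -trmx_eq0 -(mulmx_free_eq0 _ freeA) -trmx_eq0.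
by rewrite trmx_mul trmxK Ay0.
Qed.

Lemma nullV_row_orthogonal (lam : 'cV[R]_p) (y : 'cV[R]_m) :
  \sum_i (nullV A *m lam) i 0 * (- (A^T *m y)) i 0 = 0.
Proof.
rewrite -dotE mulmxN mulmxA -trmx_mul mulmxA mulmx_nullV mul0mx trmx0 mul0mx.
by rewrite !mxE oppr0.
Qed.

Lemma oss_mxE (w : pd_point R m (m + p)) (y : 'cV[R]_m) (lam : 'cV[R]_p) i :
  (oss_mx A w *m col_mx y lam) i 0 =
  pds w i 0 * (nullV A *m lam) i 0 + pdx w i 0 * (- (A^T *m y)) i 0.
Proof.
rewrite mul_row_col mulNmx -!mulmxA mxE.
by rewrite -!diagE mulmxN addrC.
Qed.

(** For a kernel vector, [s dx = - x ds] forces every [dx ds] to be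
    nonpositive, while orthogonality makes these products sum to zero; so they
    all vanish, and with them [dx] and [ds]. *)
Lemma oss_mx_unit (w : pd_point R m (m + p)) :
  (forall i, 0 < pdx w i 0) -> (forall i, 0 < pds w i 0) ->
  oss_mx A w \in unitmx.
Proof.
move=> x_gt0 s_gt0; rewrite -unitmx_tr -row_free_unit; apply: inj_row_free => v.
move=> /(congr1 trmx); rewrite trmx_mul trmxK trmx0.
rewrite -[v^T]vsubmxK.
set y := usubmx _; set lam := dsubmx _ => Mz0.
set dx := nullV A *m lam; set ds := - (A^T *m y).
have combE i : pds w i 0 * dx i 0 + pdx w i 0 * ds i 0 = 0.
  by rewrite -oss_mxE Mz0 mxE.
have prodN_ge0 i : 0 <= - (dx i 0 * ds i 0).
  have := combE i; have := s_gt0 i; have := x_gt0 i.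
  move: (pdx w i 0) (pds w i 0) (dx i 0) (ds i 0) => x s a d x0 s0 e.
  rewrite -(pmulr_rge0 _ x0).
  have -> : x * - (a * d) = s * a ^+ 2 - a * (s * a + x * d) by ring.
  by rewrite e mulr0 subr0 mulr_ge0 ?sqr_ge0 ?ltW.
have sum0 : \sum_i - (dx i 0 * ds i 0) = 0.
  by rewrite sumrN (nullV_row_orthogonal lam y) oppr0.
have prod0 i : dx i 0 * ds i 0 = 0.
  by apply/eqP; rewrite -oppr_eq0; apply/eqP; exact: (psumr_eq0P _ sum0).
have dx0 : dx = 0.
  apply/matrixP => i j; rewrite ord1 [RHS]mxE.
  have /eqP := prod0 i; rewrite mulf_eq0 => /orP[/eqP //|/eqP ds0].
  by have /eqP := combE i; rewrite ds0 mulr0 addr0 mulf_eq0 gt_eqF//= => /eqP.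
have ds0 : A^T *m y = 0.
  apply/matrixP => i j; rewrite ord1 [RHS]mxE.
  have /eqP := combE i; rewrite dx0 [(0 : 'cV_(m + p)) _ _]mxE mulr0 add0r.
  by rewrite mulf_eq0 gt_eqF//= mxE oppr_eq0 => /eqP.
apply: trmx_inj; rewrite -[v^T]vsubmxK -/y -/lam.
by rewrite (nullV_inj dx0) (trmx_full_rank_inj ds0) col_mx0 trmx0.
Qed.

(** The accuracy demanded of the approximate solution is relative to the exact
    one, which the invertibility of the system matrix provides. *)
Lemma oss_residual (eta beta : R) (w : pd_point R m (m + p)) dy lam :
  (forall i, 0 < pdx w i 0) -> (forall i, 0 < pds w i 0) ->
  0 <= eta * mu w -> oss_approx A eta beta w dy lam ->
  norm2 (oss_mx A w *m col_mx dy lam - oss_rhs beta w) <= eta * mu w.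
Proof.
move=> x_gt0 s_gt0 em_ge0 approx; have Mu := oss_mx_unit x_gt0 s_gt0.
set M := oss_mx A w in Mu *; pose z := invmx M *m oss_rhs beta w.
have Mz : M *m z = oss_rhs beta w by rewrite mulmxA mulmxV// mul1mx.
rewrite -Mz -mulmxBr; apply: (le_trans (norm2_mulmx_opnorm2 M _)).
have := approx z Mz; rewrite -/M => z_close.
apply: (le_trans (ler_wpM2l (opnorm2_ge0 M) z_close)).
(* division by a vanishing operator norm gives 0, and so does the product *)
have [->|op_neq0] := eqVneq (opnorm2 M) 0; first by rewrite mul0r.
by rewrite mulrC divfK.
Qed.
End OSS.

(** * The duality measure and the central path neighbourhood *)

Section Neighbourhood.
Variables (R : realType) (m n : nat).
Implicit Types (w : pd_point R m n).

Lemma sum_mu w :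
  (0 < n)%N -> \sum_i pdx w i 0 * pds w i 0 = n%:R * mu w.
Proof. by move=> n_gt0; rewrite /mu dotE mulrC divfK// pnatr_eq0 -lt0n. Qed.

Lemma mu_gt0 w :
  (0 < n)%N -> (forall i, 0 < pdx w i 0) -> (forall i, 0 < pds w i 0) ->
  0 < mu w.
Proof.
move=> n_gt0 x_gt0 s_gt0; rewrite /mu dotE divr_gt0 ?ltr0n//.
rewrite (bigD1 (Ordinal n_gt0))//= ltr_pwDl ?mulr_gt0// sumr_ge0// => i _.
by rewrite mulr_ge0 ?ltW.
Qed.

Lemma centralityE w i :
  (diag (pdx w) *m diag (pds w) *m ones - mu w *: ones) i 0 =
  pdx w i 0 * pds w i 0 - mu w.
Proof. by rewrite -mulmxA mxE !diagE !mxE !mulr1. Qed.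

Lemma nbhd2_entry_ge (A : 'M[R]_(m, n)) b c theta w :
  nbhd2 A b c theta w ->
  forall i, (1 - theta) * mu w <= pdx w i 0 * pds w i 0.
Proof.
move=> [_ near_mu] i; have := le_trans (norm2_entry _ i) near_mu.
by rewrite centralityE ler_norml => /andP[lo _]; lra.
Qed.

Lemma sum_centrality w :
  (0 < n)%N -> \sum_i (pdx w i 0 * pds w i 0 - mu w) = 0.
Proof.
by move=> n_gt0; rewrite sumrB sum_mu// sumr_const card_ord mulr_natl subrr.
Qed.
End Neighbourhood.

Lemma oss_rhsE (R : realType) (m p : nat) beta (w : pd_point R m (m + p)) i :
  oss_rhs beta w i 0 = beta * mu w - pdx w i 0 * pds w i 0.
Proof. by rewrite mxE [X in _ + X]mxE diagE !mxE mulr1. Qed.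

(** The right-hand side splits into the deviation from the central path and a
    multiple of the all-one vector, and these are orthogonal. The triangle
    inequality instead of Pythagoras would be too weak for the constants
    [eta], [theta] of the method when the dimension is small. *)
Lemma norm2_oss_rhs (R : realType) (m p : nat) beta theta
    (A : 'M[R]_(m, m + p)) b c (w : pd_point R m (m + p)) :
  (0 < m + p)%N -> nbhd2 A b c theta w ->
  norm2 (oss_rhs beta w) ^+ 2 <=
    (theta ^+ 2 + (m + p)%:R * (1 - beta) ^+ 2) * mu w ^+ 2.
Proof.
move=> n_gt0 [_ near_mu]; rewrite sqr_norm2.
pose cen i := pdx w i 0 * pds w i 0 - mu w.
have sqE i : oss_rhs beta w i 0 ^+ 2 =
    (cen i ^+ 2 + 2 * (1 - beta) * mu w * cen i) + (1 - beta) ^+ 2 * mu w ^+ 2.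
  by rewrite oss_rhsE /cen; ring.
rewrite (eq_bigr _ (fun i _ => sqE i)) !big_split /= -mulr_sumr.
rewrite sum_centrality// mulr0 addr0 sumr_const card_ord.
rewrite -[X in _ + X <= _]mulr_natl.
rewrite mulrDl -[X in _ <= _ + X]mulrA.
rewrite lerD2r -exprMn.
move: near_mu; set v := _ - _ => near_mu.
have := norm2_sqr_le near_mu.
rewrite sqr_norm2; congr (_ <= _); apply: eq_bigr => i _.
by rewrite centralityE.
Qed.

(** * One step of the method *)

(** For the product of two updated coordinates to be positive they must have
    the same sign, and the positive combination rules out two negative ones:
    this gives positivity of the new iterate at once, without following the
    segment from the old one. *)
Lemma both_gt0 (R : realFieldType) (s x u v : R) :
  0 < s -> 0 < x -> 0 < s * u + x * v -> 0 < u * v -> 0 < u /\ 0 < v.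
Proof.
move=> s_gt0 x_gt0 comb_gt0 uv_gt0.
have [u_gt0|u_le0] := ltP 0 u; first by rewrite -(pmulr_rgt0 _ u_gt0).
have [v_ge0|v_lt0] := leP 0 v.
  by move: uv_gt0; rewrite ltNge mulr_le0_ge0.
have su_le0 : s * u <= 0 by rewrite pmulr_rle0.
have xv_lt0 : x * v < 0 by rewrite pmulr_rlt0.
by lra.
Qed.

Section InexactNewton.
Variables (R : realType) (m p : nat).
Variables (w : pd_point R m (m + p)) (beta : R) (dx ds r : 'cV[R]_(m + p)).
Hypothesis n_gt0 : (0 < m + p)%N.
Hypothesis orth : \sum_i dx i 0 * ds i 0 = 0.
Hypothesis newton : forall i,
  pds w i 0 * dx i 0 + pdx w i 0 * ds i 0 = (oss_rhs beta w + r) i 0.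

Lemma newton_product i :
  (pdx w + dx) i 0 * (pds w + ds) i 0 = beta * mu w + r i 0 + dx i 0 * ds i 0.
Proof.
have := newton i; rewrite [(_ + r) i 0]mxE oss_rhsE [(_ + dx) i 0]mxE.
rewrite [(_ + ds) i 0]mxE.
by move: (pdx w i 0) (pds w i 0) (dx i 0) (ds i 0) (r i 0) => *; lra.
Qed.

Lemma mu_newton (y : 'cV[R]_m) :
  mu (PDPoint (pdx w + dx) y (pds w + ds)) =
  beta * mu w + (\sum_i r i 0) / (m + p)%:R.
Proof.
rewrite {1}/mu dotE /= (eq_bigr _ (fun i _ => newton_product i)).
rewrite !big_split /= orth addr0 sumr_const card_ord.
rewrite -[X in (X + _) / _]mulr_natl mulrDl.
by rewrite mulrAC mulfV ?mul1r// pnatr_eq0 -lt0n.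
Qed.

(** With [theta = 0.2], [n (1 - beta)^2 = 0.11^2] and [|r| <= 0.1 mu], the
    right-hand side [h] of the Newton equation has norm at most
    [sqrt (0.0521) mu + 0.1 mu <= 0.329 mu], and the entries of [x s] are at
    least [0.8 mu]; then [sqrt 2 * 0.329^2 / 3.2 <= 0.048]. *)
Lemma norm2_second_order (A : 'M[R]_(m, m + p)) b c :
  beta = ifipm_beta R (m + p) -> nbhd2 A b c (ifipm_theta R) w -> 0 < mu w ->
  norm2 r <= 1 / 10 * mu w -> norm2 (diag dx *m ds) <= 48 / 1000 * mu w.
Proof.
have second_order_le (h2 t : R) : 0 <= h2 -> 0 < t ->
    h2 <= (329 / 1000 * t) ^+ 2 ->
    2 * (h2 / (4 * ((1 - ifipm_theta R) * t))) ^+ 2 <= (48 / 1000 * t) ^+ 2.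
  rewrite /ifipm_theta => h2_ge0 t_gt0 h2_le; have t2_ge0 := sqr_ge0 t.
  set q := h2 / _.
  have q_ge0 : 0 <= q by apply: divr_ge0 => //; lra.
  (* 0.329 ^ 2 / 3.2 <= 0.0339, and 2 * 0.0339 ^ 2 <= 0.048 ^ 2 *)
  have q_le : q <= 339 / 10000 * t by rewrite ler_pdivrMr; lra.
  have := lerXn2r 2 q_ge0 (le_trans q_ge0 q_le) q_le.
  by lra.
move=> betaE Nw mu_pos r_le; have xs_ge := nbhd2_entry_ge Nw.
have rhs_sqr_le := norm2_oss_rhs beta n_gt0 Nw.
have sum_le := norm2D (oss_rhs beta w) r.
have part_le : norm2 (oss_rhs beta w) <= 229 / 1000 * mu w.
  have t_ge0 : 0 <= 229 / 1000 * mu w by lra.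
  rewrite -ler_sqr ?nnegrE ?norm2_ge0//; apply: (le_trans rhs_sqr_le).
  rewrite [leRHS]exprMn ler_wpM2r ?sqr_ge0// betaE /ifipm_theta /ifipm_beta.
  set g : R := Num.sqrt _.
  have g_neq0 : g != 0 by rewrite gt_eqF// sqrtr_gt0 ltr0n.
  have <- : g ^+ 2 = (m + p)%:R by rewrite sqr_sqrtr.
  have -> : g ^+ 2 * (1 - (1 - 11 / 100 / g)) ^+ 2 = (11 / 100) ^+ 2 by field.
  by lra.
have h_le : norm2 (oss_rhs beta w + r) <= 329 / 1000 * mu w by lra.
have delta_gt0 : 0 < (1 - ifipm_theta R) * mu w by rewrite /ifipm_theta; lra.
have t_ge0 : 0 <= 48 / 1000 * mu w by lra.
have dxds_sqr_le := norm2_hadamard_orthogonal delta_gt0 xs_ge orth newton.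
rewrite -ler_sqr ?nnegrE ?norm2_ge0//; apply: (le_trans dxds_sqr_le).
exact: second_order_le (sqr_ge0 _) mu_pos (norm2_sqr_le h_le).
Qed.
End InexactNewton.

Section Step.
Variables (R : realType) (m p : nat) (A : 'M[R]_(m, m + p)).
Variables (b : 'cV[R]_m) (c : 'cV[R]_(m + p)).
Hypothesis n_gt0 : (0 < m + p)%N.
Hypothesis rankA : \rank A = m.
Hypothesis freeAB : row_free (lsubmx A)^T.

Lemma ifipm_step_nbhd (w w' : pd_point R m (m + p)) :
  nbhd2 A b c (ifipm_theta R) w ->
  ifipm_step A (ifipm_eta R) (ifipm_beta R (m + p)) w w' ->
  nbhd2 A b c (ifipm_theta R) w' /\
  mu w' <= (1 - 1 / 100 / Num.sqrt (m + p)%:R) * mu w.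
Proof.
move=> Nw [dy [lam [approx w'E]]].
have [[Ax Ays x_gt0 s_gt0] _] := Nw.
have xs_ge := nbhd2_entry_ge Nw.
have mu_pos := mu_gt0 n_gt0 x_gt0 s_gt0.
set beta := ifipm_beta R (m + p) in approx *.
set g : R := Num.sqrt (m + p)%:R.
have g_ge1 : 1 <= g by rewrite -sqrtr1 ler_wsqrtr// ler1n.
have g_gt0 : 0 < g by lra.
have ginv_le1 : g^-1 <= 1 by rewrite invf_le1.
have mug_gt0 : 0 < g^-1 * mu w by rewrite mulr_gt0 ?invr_gt0.
have mug_le : g^-1 * mu w <= mu w by rewrite ler_piMl// ltW.
have betaE : beta = 1 - 11 / 100 / g by [].
pose dx := nullV A *m lam; pose ds := - (A^T *m dy).
pose r := oss_mx A w *m col_mx dy lam - oss_rhs beta w.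
have r_le : norm2 r <= 1 / 10 * mu w.
  by apply: oss_residual => //; rewrite mulr_ge0 ?ltW// /ifipm_eta; lra.
have orth : \sum_i dx i 0 * ds i 0 = 0 by exact: nullV_row_orthogonal.
have newton i :
    pds w i 0 * dx i 0 + pdx w i 0 * ds i 0 = (oss_rhs beta w + r) i 0.
  by rewrite -oss_mxE /r addrC subrK.
have dxds_le : norm2 (diag dx *m ds) <= 48 / 1000 * mu w.
  exact: (norm2_second_order n_gt0 orth newton erefl Nw).
pose a := (\sum_i r i 0) / (m + p)%:R.
have a_le : `|a| <= 1 / 10 * (g^-1 * mu w).
  apply: (le_trans (abs_mean_le _ n_gt0)); rewrite -/g mulrCA mulrC.
  by rewrite ler_wpM2l// invr_ge0 ltW.
have mu'E : mu w' = beta * mu w + a by rewrite w'E; exact: mu_newton.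
have mu'_ge : 79 / 100 * mu w <= mu w'.
  by rewrite mu'E betaE; move: a_le; rewrite ler_norml => /andP[a_ge _]; lra.
have prodE := newton_product newton.
have near' : norm2 (diag (pdx w') *m diag (pds w') *m ones - mu w' *: ones)
    <= ifipm_theta R * mu w'.
  have -> : diag (pdx w') *m diag (pds w') *m ones - mu w' *: ones =
      r - a *: ones + diag dx *m ds.
    apply/matrixP => i j; rewrite ord1 centralityE mu'E w'E prodE.
    by rewrite [RHS]mxE diagE !mxE mulr1; ring.
  apply: (le_trans (norm2D _ _)).
  by have := norm2_center r; rewrite -/a /ifipm_theta; lra.
have xs'_gt0 i : 0 < (pdx w + dx) i 0 * (pds w + ds) i 0.
  have := le_trans (norm2_entry _ i) near'; rewrite centralityE {1}w'E /=.
  by rewrite w'E /= -w'E ler_norml /ifipm_theta => /andP[lo _]; lra.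
have comb_gt0 i : 0 < pds w i 0 * (pdx w + dx) i 0 +
    pdx w i 0 * (pds w + ds) i 0.
  have := xs_ge i; rewrite /ifipm_theta.
  have := le_trans (norm2_entry r i) r_le; rewrite ler_norml => /andP[r_ge _].
  have := newton i; rewrite [(_ + r) i 0]mxE oss_rhsE betaE.
  rewrite [(_ + dx) i 0]mxE [(_ + ds) i 0]mxE.
  by move: (pdx w i 0) (pds w i 0) (dx i 0) (ds i 0) (r i 0) r_ge => *; lra.
have pos' i := both_gt0 (s_gt0 i) (x_gt0 i) (comb_gt0 i) (xs'_gt0 i).
split.
  split=> //; rewrite w'E; split=> /=.
  - by rewrite mulmxDr Ax mulmxA mulmx_nullV// mul0mx addr0.
  - by rewrite mulmxDr addrCA -addrA subrr addr0 addrC.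
  - by move=> i; have [] := pos' i.
  - by move=> i; have [] := pos' i.
by rewrite mu'E betaE; move: a_le; rewrite ler_norml => /andP[_ a_le]; lra.
Qed.

(** * Runs of the method *)

Lemma ifipm_run_nbhd (w : nat -> pd_point R m (m + p)) K k :
  ifipm_run A b c w K -> (k <= K)%N -> nbhd2 A b c (ifipm_theta R) (w k).
Proof.
move=> [w0 step]; elim: k => [//|k IH] kK.
by have [] := ifipm_step_nbhd (IH (ltnW kK)) (step k kK).
Qed.

Lemma ifipm_run_mu_gt0 (w : nat -> pd_point R m (m + p)) K k :
  ifipm_run A b c w K -> (k <= K)%N -> 0 < mu (w k).
Proof.
move=> run kK; have [[_ _ x_gt0 s_gt0] _] := ifipm_run_nbhd run kK.
exact: mu_gt0.
Qed.

Lemma ifipm_run_mu_decr (w : nat -> pd_point R m (m + p)) K k :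
  ifipm_run A b c w K -> (k < K)%N ->
  mu (w k.+1) <= (1 - 1 / 100 / Num.sqrt (m + p)%:R) * mu (w k).
Proof.
move=> run kK; have [_ step] := run.
by have [] := ifipm_step_nbhd (ifipm_run_nbhd run (ltnW kK)) (step k kK).
Qed.

Lemma contraction_bounds :
  0 <= (1 - 1 / 100 / Num.sqrt (m + p)%:R : R) < 1.
Proof.
set g : R := Num.sqrt _.
have g_ge1 : 1 <= g by rewrite -sqrtr1 ler_wsqrtr// ler1n.
have g_gt0 : 0 < g by lra.
have : 0 < g^-1 by rewrite invr_gt0.
have : g^-1 <= 1 by rewrite invf_le1.
by move=> *; apply/andP; split; lra.
Qed.

Lemma ifipm_run_mu_geometric (w : nat -> pd_point R m (m + p)) K k :
  ifipm_run A b c w K -> (k <= K)%N ->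
  mu (w k) <= (1 - 1 / 100 / Num.sqrt (m + p)%:R) ^+ k * mu (w 0%N).
Proof.
move=> run; elim: k => [|k IH] kK; first by rewrite expr0 mul1r.
apply: (le_trans (ifipm_run_mu_decr run kK)).
have /andP[rho_ge0 _] := contraction_bounds.
by rewrite exprS -[leRHS]mulrA ler_wpM2l// IH// ltnW.
Qed.
End Step.

Theorem theorem2p6 (R : realType) :
  exists C : R, 0 < C /\
  forall (m p : nat) (A : 'M[R]_(m, m + p)) (b : 'cV[R]_m) (c : 'cV[R]_(m + p)),
    (0 < m + p)%N ->
    \rank A = m ->
    row_free (lsubmx A)^T ->
    PD0 A b c !=set0 ->
    (forall w : nat -> pd_point R m (m + p),
       (forall K : nat, ifipm_run A b c w K) ->
       converges_linearly (fun k => mu (w k)) 0) /\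
    (forall (zeta : R) (w : nat -> pd_point R m (m + p)) (K : nat),
       0 < zeta ->
       ifipm_run A b c w K ->
       C * (Num.sqrt (m + p)%:R * ln (mu (w 0%N) / zeta)) <= K%:R ->
       mu (w K) <= zeta).
Proof.
exists 100; split=> [|m p A b c n_gt0 rankA freeAB _]; first by lra.
have /andP[rho_ge0 rho_lt1] := contraction_bounds R n_gt0.
set g : R := Num.sqrt (m + p)%:R in rho_ge0 rho_lt1 *.
set rho := 1 - _ in rho_ge0 rho_lt1 *.
split=> [w run|zeta w K zeta_gt0 run K_ge].
  have mu_pos k : 0 < mu (w k).
    exact: (ifipm_run_mu_gt0 n_gt0 rankA freeAB (run k)).
  split.
    have geo_cvg : geometric (mu (w 0%N)) rho @ \oo --> 0.
      by apply: cvg_geometric; rewrite ger0_norm.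
    have zero_cvg : (fun=> 0 : R) @ \oo --> (0 : R) by exact: cvg_cst.
    apply: squeeze_cvgr zero_cvg geo_cvg; apply: nearW => k.
    rewrite ltW//= mulrC.
    exact: (ifipm_run_mu_geometric n_gt0 rankA freeAB (run k)).
  exists rho; split=> // k; rewrite !subr0 !gtr0_norm//.
  exact: (ifipm_run_mu_decr n_gt0 rankA freeAB (run k.+1)).
have mu0_gt0 : 0 < mu (w 0%N).
  exact: (ifipm_run_mu_gt0 n_gt0 rankA freeAB run).
have g_gt0 : 0 < g by rewrite sqrtr_gt0 ltr0n.
have geo := ifipm_run_mu_geometric n_gt0 rankA freeAB run (leqnn K).
apply: (le_trans geo); rewrite -/g -/rho -ler_pdivlMr//.
have rho_exp : rho <= expR (- (1 / 100 / g)) by exact: expR_ge1Dx.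
apply: (@le_trans _ _ (expR (- (1 / 100 / g)) ^+ K)).
  by rewrite lerXn2r// nnegrE expR_ge0.
have ratio_gt0 : 0 < mu (w 0%N) / zeta by rewrite divr_gt0.
rewrite -expRM_natl -[leRHS]invf_div -[mu _ / zeta]lnK// -expRN.
rewrite ler_expR mulrN lerN2.
set L := ln _ in K_ge *.
have -> : K%:R * (1 / 100 / g) = K%:R / (100 * g) by field; rewrite gt_eqF.
by rewrite ler_pdivlMr ?mulr_gt0//; lra.
Qed.
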